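(* The only pair $(n,x)$ of positive integers with $n\geq 2$ satisfying $(3^{n}-2)(45^{n}-2)=x^{2}$ is $(n,x)=(2,119)$. *)

(* Defs.v *)
From mathcomp Require Import all_boot all_order all_algebra.

(* Main.v *)
Require Import Defs.
From mathcomp Require Import all_boot all_order all_algebra.
From mathcomp Require Import zify ring.
Import Order.TTheory GRing.Theory Num.Theory.
Local Open Scope ring_scope.

(* Modulo 4 the exponent is even, say [n = 2m].  Then [3^n - 2 = D y^2] and
   [45^n - 2 = D z^2] for a common [D], so [3^m] and [45^m] are first
   coordinates of solutions of [X^2 - D Y^2 = 2].  If [(a, b)] is the least
   solution, all first coordinates are [a w_k], where [w_0 = 1],
   [w_1 = c = 2 a^2 - 3] and [w_(k+2) = (c + 1) w_(k+1) - w_k].  Modulo [c],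
   every [w_k] is [0], [1] or [-1].  Were [3^m = a w_k] with [k > 0], then
   [3] would divide [a], [c] and [w_k], so [c] would divide [w_k] and be a power of [3],
   which it is not as [c = -3] modulo 9 and [c > 3].  Hence [a = 3^m], and
   [15^m = w_k]: since [w_2 > 15^m], we get [15^m = w_1 = 2 * 9^m - 3], which
   modulo 9 forces [m = 1]. *)

(** * Solutions of [X^2 - D Y^2 = 2] *)

(* Division of [u + v sqrt D] by the unit [(a + b sqrt D) ^ 2 / 2]. *)
Lemma pell2_descent (D a b u v : int) :
  0 < D -> 0 < a -> 0 < b -> a * a = D * b * b + 2 ->
  0 < u -> b < v -> u * u = D * v * v + 2 ->
  let u' := u * (a * a - 1) - a * b * D * v in
  let v' := v * (a * a - 1) - u * a * b in
  [/\ 0 < u', - b < v' < v, u' * u' = D * v' * v' + 2,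
      u = u' * (a * a - 1) + a * b * D * v' &
      v = v' * (a * a - 1) + u' * a * b].
Proof.
move=> D0 a0 b0 ab u0 bv uv u' v'.
have ltsq (x y : int) : 0 <= y -> x * x < y * y -> x < y by nia.
have Dbb : D * b * b = a * a - 2 by lia.
have Dvv : D * v * v = u * u - 2 by lia.
have a2 : 3 <= a * a by nia.
(* Both bounds on [v'] compare [u a b] with another term; squaring and using the two equations
   eliminates [u] and [D]. *)
have abuv : (u * a * b) * (u * a * b) =
    2 * (a * a) * (b * b) + v * v * (a * a - 2) * (a * a).
  transitivity (u * u * (a * a) * (b * b)); first by ring.
  by rewrite uv -Dbb; ring.
(* The unit is [a^2 - 1 + a b sqrt D], of norm 1. *)
have unit_norm : (a * a - 1) * (a * a - 1) - a * a * (D * b * b) = 1.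
  by rewrite Dbb; ring.
split.
- rewrite /u' subr_gt0; apply: ltsq; first nia.
  have -> : a * b * D * v * (a * b * D * v) = a * a * (D * b * b) * (D * v * v)
    by ring.
  rewrite Dbb Dvv; nia.
- apply/andP; split.
    suff : u * a * b < v * (a * a - 1) + b by rewrite /v'; lia.
    apply: ltsq; first nia.
    rewrite abuv -subr_gt0.
    have -> : (v * (a * a - 1) + b) * (v * (a * a - 1) + b) -
       (2 * (a * a) * (b * b) + v * v * (a * a - 2) * (a * a)) =
       (v - b) * (v - b) + 2 * (a * a) * b * (v - b) by ring.
    have : 0 < 2 * (a * a) * b * (v - b) by nia.
    nia.
  suff : v * (a * a - 2) < u * a * b by rewrite /v'; lia.
  apply: ltsq; first nia.
  rewrite abuv -subr_gt0.
  have -> : 2 * (a * a) * (b * b) + v * v * (a * a - 2) * (a * a) -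
     v * (a * a - 2) * (v * (a * a - 2)) =
     2 * (a * a) * (b * b) + 2 * (v * v) * (a * a - 2) by ring.
  nia.
- apply/eqP; rewrite -subr_eq0 opprD addrA subr_eq0; apply/eqP.
  transitivity ((u * u - D * v * v) *
    ((a * a - 1) * (a * a - 1) - a * a * (D * b * b))).
    by rewrite /u' /v'; ring.
  by rewrite unit_norm uv; ring.
- transitivity (u * ((a * a - 1) * (a * a - 1) - a * a * (D * b * b))).
    by rewrite unit_norm; ring.
  by rewrite /u' /v'; ring.
- transitivity (v * ((a * a - 1) * (a * a - 1) - a * a * (D * b * b))).
    by rewrite unit_norm; ring.
  by rewrite /u' /v'; ring.
Qed.

(* If [a + b sqrt D] has norm 2 then its [2k+1]-st power over [2 ^ k] is
   [a w + b t sqrt D] with [(w, t) = orbit (a * a) k]. *)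
Definition orbit (s : int) (k : nat) : int * int :=
  iter k (fun p => ((s - 1) * p.1 + (s - 2) * p.2, s * p.1 + (s - 1) * p.2))
    (1, 1).

Lemma orbitS (s : int) (k : nat) : let p := orbit s k in
  orbit s k.+1 = ((s - 1) * p.1 + (s - 2) * p.2, s * p.1 + (s - 1) * p.2).
Proof. by []. Qed.

Lemma sqr_neq2 (w : int) : w * w <> 2.
Proof.
have [w_le|[w_ge|[->|[->|->]]]] :
  w <= -2 \/ 2 <= w \/ w = 0 \/ w = 1 \/ w = -1 by lia.
all: nia.
Qed.

(** Dividing by the unit lowers [v] until minimality forces [v = b]; multiplying back runs through
    the orbit. *)
Lemma pell2_orbit (D a b : int) :
  0 < D -> 0 < a -> 0 < b -> a * a = D * b * b + 2 ->
  (forall u v : int, 0 < u -> 0 < v -> u * u = D * v * v + 2 -> b <= v) ->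
  forall u v : int, 0 < u -> 0 < v -> u * u = D * v * v + 2 ->
  exists k, u = a * (orbit (a * a) k).1 /\ v = b * (orbit (a * a) k).2.
Proof.
move=> D0 a0 b0 ab bmin u v.
have [N] := ubnP `|v|%N; elim: N => // N IH in u v *.
move=> vN u0 v0 uv.
have [bv | vb] := boolP (b < v); last first.
  have {}vb : v = b by have := bmin u v u0 v0 uv; lia.
  exists 0%N; rewrite /= !mulr1; split=> //.
  by move: uv; rewrite vb -ab; nia.
have [] := @pell2_descent D a b u v D0 a0 b0 ab u0 bv uv.
set u' := u * _ - _; set v' := v * _ - _ => u'0 /andP[bv' v'v] uv' uE vE.
(* [v' = 0] would make 2 a square, and [v' < 0] would give a solution with second coordinate
   [-v' < b]. *)
have v'0 : 0 < v'.
  have [//|v'_le0] := boolP (0 < v').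
  have [v'E|v'_neq0] := eqVneq v' 0.
    by case: (@sqr_neq2 u'); rewrite uv' v'E mulr0.
  have v'N : 0 < - v' by lia.
  by have := bmin u' (- v') u'0 v'N; rewrite uv' !(mulrN, mulNr) opprK; lia.
have [|k [u'E v'E]] := IH u' v' _ u'0 v'0 uv'; first lia.
exists k.+1; rewrite orbitS /=.
rewrite uE vE u'E v'E; split; last by ring.
transitivity (a * ((a * a - 1) * (orbit (a * a) k).1 +
  (D * b * b) * (orbit (a * a) k).2)); first by ring.
by rewrite ab; ring.
Qed.

(** * Growth and residues of the orbit *)

Lemma orbit_gt0 (s : int) k : 3 <= s -> 0 < (orbit s k).1 /\ 0 < (orbit s k).2.
Proof.
move=> s3; elim: k => [|k [w0 t0]] //.
by rewrite orbitS /=; split; nia.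
Qed.

Lemma orbitS_gt (s : int) k : 3 <= s -> (orbit s k).1 < (orbit s k.+1).1.
Proof.
move=> s3; have [w0 t0] := @orbit_gt0 s k s3.
by rewrite orbitS /=; nia.
Qed.

Lemma orbit_ge (s : int) j k :
  3 <= s -> (orbit s j).1 <= (orbit s (j + k)).1.
Proof.
move=> s3; elim: k => [|k IH]; first by rewrite addn0.
by rewrite addnS; have := @orbitS_gt s (j + k) s3; lia.
Qed.

(** Modulo [c] the recurrence reads [w_(k+2) = w_(k+1) - w_k], so [w_(k+3) = - w_k], starting from
    1, 0, -1. *)
Lemma orbit_mod (s : int) k : let c := 2 * s - 3 in
  exists q e : int, (orbit s k).1 = c * q + e /\ (e = 0 \/ e = 1 \/ e = -1).
Proof.
have rec j : exists q, (orbit s j.+3).1 = (2 * s - 3) * q - (orbit s j).1.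
  exists ((orbit s j.+1).1 + (orbit s j.+2).1).
  by rewrite !orbitS /=; ring.
elim/ltn_ind: k => -[|[|[|k]]] IH.
- by exists 0, 1; split; [rewrite /=; ring | auto].
- by exists 1, 0; split; [rewrite /=; ring | auto].
- by exists (2 * s - 2), (-1); split; [rewrite /=; ring | auto].
have [q [e [wE eE]]] := IH k ltac:(lia).
have [q' ->] := rec k; exists (q' - q), (- e); split; last lia.
by rewrite wE; ring.
Qed.


(** * Powers of 3 and 45 as first coordinates *)

Lemma PoszX (k n : nat) : (k ^ n)%N%:Z = k%:Z ^+ n.
Proof. by rewrite -natz natrX natz. Qed.

Lemma divisor_pow3 (d e : int) (m : nat) :
  0 < d -> 3%:Z ^+ m = d * e -> exists j, d = 3%:Z ^+ j.
Proof.
move=> d0 /(congr1 absz); rewrite abszX abszM => dE.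
have /(dvdn_pfactor _ _ (isT : prime 3))[j _ jE] : (`|d| %| 3 ^ m)%N.
  by rewrite [X in (_ %| X)%N]dE dvdn_mulr.
by exists j; rewrite -[LHS]gtz0_abs // jE PoszX.
Qed.

Lemma pow3_neq9Bl3 (j : nat) (q : int) : 2 <= q -> 3%:Z ^+ j <> 9 * q - 3.
Proof.
case: j => [|[|j]] q2; rewrite ?expr0 ?expr1 ?exprS; lia.
Qed.

Lemma pell2_minimal (D u v : int) :
  0 < D -> 0 < u -> 0 < v -> u * u = D * v * v + 2 ->
  exists a b : int, [/\ 0 < a, 0 < b, a * a = D * b * b + 2 &
   forall u v : int, 0 < u -> 0 < v -> u * u = D * v * v + 2 -> b <= v].
Proof.
move=> D0 u0 v0 uv.
(* Bounding [a] by its square makes [P] boolean, so a least [b] can be extracted. *)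
pose P b := (0 < b)%N && [exists a : 'I_(`|D * b%:Z * b%:Z + 2|.+1),
  a%:Z * a%:Z == D * b%:Z * b%:Z + 2].
have PI (x y : int) : 0 < x -> 0 < y -> x * x = D * y * y + 2 -> P `|y|%N.
  move=> x0 y0 xy; rewrite /P; apply/andP; split; first lia.
  have yE : `|y|%N%:Z = y by lia.
  rewrite !yE -xy; have xx : (`|x| < `|(x * x)%R|.+1)%N by nia.
  by apply/existsP; exists (Ordinal xx) => /=; apply/eqP; nia.
have exP : exists b, P b by exists `|v|%N; exact: PI uv.
case: (ex_minnP exP) => b /andP[b0 /existsP[a /eqP ab]] bmin.
exists (a : nat)%:Z, b%:Z; split=> //.
  by have [a0|] := posnP a; [rewrite a0 in ab; nia | lia].
by move=> x y x0 y0 xy; have := bmin _ (PI x y x0 y0 xy); lia.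
Qed.

Lemma pell2_pow3_minimal (D a b y : int) (m : nat) :
  0 < D -> 0 < a -> 0 < b -> a * a = D * b * b + 2 ->
  (forall u v : int, 0 < u -> 0 < v -> u * u = D * v * v + 2 -> b <= v) ->
  0 < y -> 3%:Z ^+ m * 3%:Z ^+ m = D * y * y + 2 -> a = 3%:Z ^+ m.
Proof.
move=> D0 a0 b0 ab bmin y0 my.
have s3 : 3 <= a * a by nia.
have m0 : 0 < 3%:Z ^+ m by apply: exprn_gt0.
have [k [mE _]] := @pell2_orbit D a b D0 a0 b0 ab bmin _ y m0 y0 my.
have [i aE] := @divisor_pow3 a _ m a0 mE.
have [w0 _] := @orbit_gt0 (a * a) k s3.
rewrite [RHS]mE; case: k => [|k] in mE w0 *; first by rewrite mulr1.
have [j wE] := @divisor_pow3 _ a m w0 (etrans mE (mulrC _ _)).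
have w_gt1 : 1 < (orbit (a * a) k.+1).1.
  have := @orbit_ge (a * a) 0 k s3; rewrite add0n.
  by have := @orbitS_gt (a * a) k s3; rewrite /=; lia.
have [r aE3] : exists r, a = 3 * r.
  case: i aE => [|i] aE; last by exists (3 ^+ i); rewrite -exprS.
  by move: s3; rewrite aE expr0.
have [r' wE3] : exists r, (orbit (a * a) k.+1).1 = 3 * r.
  case: j wE => [|j] wE; last by exists (3 ^+ j); rewrite -exprS.
  by move: w_gt1; rewrite wE expr0.
(* Since 3 divides [a], it divides [c = 2 a^2 - 3]; it also divides [w_k], hence [e], which rules
   out [e = 1] and [e = -1]. *)
have [q [e [wq [e0|eE]]]] := @orbit_mod (a * a) k.+1; last first.
  by move: wq; rewrite wE3 aE3; nia.
have c0 : 0 < 2 * (a * a) - 3 by lia.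
have [l] := @divisor_pow3 (2 * (a * a) - 3) (q * a) m c0
  ltac:(by rewrite [LHS]mE wq e0; ring).
have -> : 2 * (a * a) - 3 = 9 * (2 * (r * r)) - 3 by rewrite aE3; ring.
by move=> /esym/pow3_neq9Bl3[]; nia.
Qed.

Lemma pell2_pow3_pow45 (D y z : int) (m : nat) :
  (0 < m)%N -> 0 < D -> 0 < y -> 0 < z ->
  3%:Z ^+ m * 3%:Z ^+ m = D * y * y + 2 ->
  45%:Z ^+ m * 45%:Z ^+ m = D * z * z + 2 -> m = 1%N.
Proof.
move=> m_gt0 D0 y0 z0 my mz.
have m0 : 0 < 3%:Z ^+ m by apply: exprn_gt0.
have [a [b [a0 b0 ab bmin]]] := @pell2_minimal D _ y D0 m0 y0 my.
have aE := @pell2_pow3_minimal D a b y m D0 a0 b0 ab bmin y0 my.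
have m0' : 0 < 45%:Z ^+ m by apply: exprn_gt0.
have [k [mE _]] := @pell2_orbit D a b D0 a0 b0 ab bmin _ z m0' z0 mz.
have {}mE : 15%:Z ^+ m = (orbit (a * a) k).1.
  have /mulfI : a != 0 by lia.
  by apply; rewrite -[RHS]mE aE -exprMn.
have s3 : 3 <= a * a by nia.
have [r aE3] : exists r, a = 3 * r.
  by exists (3 ^+ m.-1); rewrite -exprS prednK.
case: k mE => [|[|k]] mE.
- have : 1 < 15%:Z ^+ m by rewrite exprn_egt1 // -lt0n.
  by rewrite mE.
- case: m m_gt0 mE {my mz m0 m0' aE} => [|[|m]] // _.
  rewrite /= !exprS aE3; lia.
(* [w_2 = 4 a^4 - 10 a^2 + 5] exceeds [a^4 = 81^m], hence [15^m]. *)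
- have := @orbit_ge (a * a) 2 k s3; rewrite add2n -mE /=.
  have : 15%:Z ^+ m <= a * a * (a * a).
    by rewrite aE -!exprMn; apply: ler_pXn2r.
  nia.
Qed.

(** * Factors of a perfect square *)

(** The root is [d = gcd(a, z)]: with [a = a' d] and [z = z' d], the equation becomes
    [a' b = d z'^2], and coprimality gives [a' = d] by mutual divisibility. *)
Lemma coprime_mul_sqr (a b z : nat) :
  (0 < a)%N -> coprime a b -> (a * b = z ^ 2)%N -> exists y, a = (y ^ 2)%N.
Proof.
move=> a0 ab abz; set d := gcdn a z.
have d0 : (0 < d)%N by rewrite gcdn_gt0 a0.
have [a' aE] := dvdnP (dvdn_gcdl a z : d %| a)%N.
have [z' zE] := dvdnP (dvdn_gcdr a z : d %| z)%N.
have cop : coprime a' z'.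
  by rewrite /coprime -(eqn_pmul2r d0) mul1n muln_gcdl -aE -zE.
have E : (a' * b = d * z' ^ 2)%N.
  by apply/eqP; rewrite -(eqn_pmul2l d0); apply/eqP; nia.
exists d; rewrite expnS expn1 [LHS]aE; congr (_ * _)%N.
apply/eqP; rewrite eqn_dvd; apply/andP; split.
  by rewrite -(@Gauss_dvdl _ _ (z' ^ 2)) ?coprimeXr // -E dvdn_mulr.
rewrite -(@Gauss_dvdl _ _ b) ?E ?dvdn_mulr //.
by apply: coprime_dvdl ab; rewrite dvdn_gcdl.
Qed.

(** For [D] the gcd, the cofactors are coprime with square product, so each is a square. *)
Lemma mul_sqr_gcd (A B x : nat) :
  (0 < A)%N -> (0 < B)%N -> (A * B = x ^ 2)%N ->
  exists D y z, A = (D * y ^ 2)%N /\ B = (D * z ^ 2)%N.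
Proof.
move=> A0 B0 ABx; set g := gcdn A B.
have g0 : (0 < g)%N by rewrite gcdn_gt0 A0.
have [a aE] := dvdnP (dvdn_gcdl A B : g %| A)%N.
have [b bE] := dvdnP (dvdn_gcdr A B : g %| B)%N.
have cop : coprime a b.
  by rewrite /coprime -(eqn_pmul2r g0) mul1n muln_gcdl -aE -bE.
have [w wE] : exists w, x = (w * g)%N.
  by apply/dvdnP; rewrite -(@dvdn_pexp2r _ _ 2) // -ABx aE bE; apply/dvdnP;
    exists (a * b)%N; lia.
have abw : (a * b = w ^ 2)%N.
  have gg0 : (0 < g ^ 2)%N by rewrite expn_gt0 g0.
  by apply/eqP; rewrite -(eqn_pmul2r gg0); apply/eqP; nia.
have [y yE] := @coprime_mul_sqr a b w ltac:(nia) cop abw.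
have [|z zE] := @coprime_mul_sqr b a w ltac:(nia) _ ltac:(lia).
  by rewrite coprime_sym.
by exists g, y, z; rewrite -yE -zE; split; rewrite mulnC.
Qed.

(** * Parity of the exponent and conclusion *)

Lemma expr_4q1 (q : int) (m : nat) : exists p, (4 * q + 1) ^+ m = 4 * p + 1.
Proof.
elim: m => [|m [p IH]]; first by exists 0; rewrite expr0.
by exists (4 * p * q + p + q); rewrite exprS IH; ring.
Qed.

Theorem theorem30 (n x : nat) :
  [/\ (2 <= n)%N, (0 < x)%N
    & (3%:Z ^+ n - 2) * (45%:Z ^+ n - 2) = x%:Z ^+ 2]
  <-> (n, x) = (2%N, 119%N).
Proof.
split; last by case=> -> ->.
case=> n2 x0 nx.
have [odd_n|even_n] := boolP (odd n).
  (* [9 = 4 * 2 + 1] and [45^2 = 4 * 506 + 1], so for odd [n] the product is 3 modulo 4 and no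
     square. *)
  have [p pE] := @expr_4q1 2 n./2.
  have [q qE] := @expr_4q1 506 n./2.
  have nE : n = (n./2 * 2).+1 by lia.
  have n3 : 3%:Z ^+ n = 3 * (4 * p + 1).
    by rewrite nE exprS mulnC exprM -pE.
  have n45 : 45%:Z ^+ n = 45 * (4 * q + 1).
    by rewrite nE exprS mulnC exprM -qE.
  exfalso; move: nx; rewrite n3 n45 expr2.
  have -> : (3 * (4 * p + 1) - 2) * (45 * (4 * q + 1) - 2) =
    4 * (540 * (p * q) + 129 * p + 45 * q + 10) + 3 by ring.
  have [r [->|->]] : exists r : int, x%:Z = 2 * r \/ x%:Z = 2 * r + 1.
    by exists (x./2)%:Z; lia.
    have -> : 2 * r * (2 * r) = 4 * (r * r) by ring.
    lia.
  have -> : (2 * r + 1) * (2 * r + 1) = 4 * (r * r + r) + 1 by ring.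
  lia.
have nE : n = (2 * n./2)%N by lia.
set m := n./2 in nE.
have m_gt0 : (0 < m)%N by lia.
(* This makes truncated subtraction of 2 exact and both factors positive. *)
have gt2 k : (3 <= k -> 2 < k ^ n)%N.
  by move=> k3; apply: (@leq_trans (k ^ 1)); rewrite ?leq_pexp2l //; lia.
have n3 := gt2 3%N isT; have n45 := gt2 45%N isT.
have subZ (k : nat) : (2 < k ^ n)%N -> (k ^ n - 2)%N%:Z = k%:Z ^+ n - 2.
  by move=> k_gt2; rewrite -PoszX; lia.
have nxN : ((3 ^ n - 2) * (45 ^ n - 2))%N = (x ^ 2)%N.
  apply/eqP; rewrite -eqz_nat; apply/eqP.
  by rewrite [RHS]PoszX -nx -!subZ.
have [||D [y [z [yE zE]]]] := @mul_sqr_gcd _ _ x _ _ nxN.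
- by rewrite subn_gt0.
- by rewrite subn_gt0.
have pellZ (k w : nat) : (2 < k ^ n)%N -> (k ^ n - 2 = D * w ^ 2)%N ->
    k%:Z ^+ m * k%:Z ^+ m = D%:Z * w%:Z * w%:Z + 2.
  move=> k_gt2 kE; rewrite -exprD addnn -mul2n -nE.
  have := subZ k k_gt2; rewrite kE PoszM PoszX expr2 mulrA; lia.
have m1 : m = 1%N.
  apply: (@pell2_pow3_pow45 D y z m m_gt0); [nia|nia|nia| |].
    exact: pellZ.
  exact: pellZ.
move: nE nx; rewrite m1 => -> nx; congr (_, _).
(* At [n = 2] the product is [7 * 2023 = 119^2]. *)
have : x%:Z * x%:Z = 119 * 119 by rewrite -expr2 -nx.
nia.
Qed.
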